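(* Let $A$ be a finite-dimensional ordered Banach algebra with a disjunctive product and let $a,b\in A$. If the element $a$ is irreducible, then $0\le b<a$ implies $r(b)<r(a)$.
   Context: An ordered Banach algebra is a complex Banach algebra $A$ with unit $\mathbf e\neq0$ and a closed convex cone $A^+$ (closed under sums and multiplication by non-negative reals, $A^+\cap(-A^+)=\{0\}$) such that $\mathbf e\in A^+$ and $ab\in A^+$ for $a,b\in A^+$. Write $a\ge b$ if $a-b\in A^+$, and $a>b$ if $a\ge b$ and $a\ne b$. $r(a)$ is the spectral radius. Order idempotents: ${\bf OI}(A)=\{p\in A:p^2=p,\ 0\le p\le\mathbf e\}$; with the induced order it is a Boolean algebra with $p\wedge q=pq$, $p\vee q=p+q-pq$; put $p^{\rm d}=\mathbf e-p$. An element $a\in A^+$ is order continuous if $p_\alpha a\downarrow0$ and $ap_\alpha\downarrow0$ in $A$ whenever a net $p_\alpha\downarrow0$ in ${\bf OI}(A)$ ($\downarrow0$: decreasing with infimum $0$ in the indicated ordered set); $A_{\rm n}$ is the set of such elements. $A$ has a disjunctive product if for any $a,b\in A_{\rm n}$ with $ab=0$ there is $p\in{\bf OI}(A)$ with $ap=p^{\rm d}b=0$. An element $a\in A^+$ is irreducible if $p^{\rm d}ap=0$ with $p\in{\bf OI}(A)$ implies $p=0$ or $p=\mathbf e$. *)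

(* Defs.v *)
From HB Require Import structures.
From mathcomp Require Import all_boot all_order all_algebra.
From mathcomp Require Import all_classical all_reals all_analysis.
From mathcomp Require Import complex.

Set Implicit Arguments.
Unset Strict Implicit.
Unset Printing Implicit Defensive.

Import Order.TTheory GRing.Theory Num.Theory.
Import numFieldNormedType.Exports.

Local Open Scope classical_set_scope.
Local Open Scope ring_scope.
Local Open Scope complex_scope.

(* Hierarchy-Builder cannot join the normed-module and algebra hierarchies over a
   variable carrier (every numDomainType is normed over itself, which makes the
   join ambiguous), so a Banach algebra is a complete normed module bundled with
   a product; [banach_carrier] then receives both library structures.  The unit
   is nonzero but is not required to have norm 1. *)
Record banachAlgType (K : numFieldType) := BanachAlgebra {
  banach_space : completeNormedModType K;
  banach_mul : banach_space -> banach_space -> banach_space;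
  banach_one : banach_space;
  banach_mulA : associative banach_mul;
  banach_mul1l : left_id banach_one banach_mul;
  banach_mul1r : right_id banach_one banach_mul;
  banach_mulDl : left_distributive banach_mul +%R;
  banach_mulDr : right_distributive banach_mul +%R;
  banach_one_neq0 : banach_one != 0;
  banach_scaleAl : forall (k : K) (x y : banach_space),
    k *: banach_mul x y = banach_mul (k *: x) y;
  banach_scaleAr : forall (k : K) (x y : banach_space),
    k *: banach_mul x y = banach_mul x (k *: y);
  banach_norm_submult : forall x y : banach_space,
    `|banach_mul x y| <= `|x| * `|y|
}.

Definition banach_carrier (K : numFieldType) (A : banachAlgType K) : Type :=
  banach_space A.
Coercion banach_carrier : banachAlgType >-> Sortclass.

HB.instance Definition _ (K : numFieldType) (A : banachAlgType K) :=
  CompleteNormedModule.copy (banach_carrier A) (banach_space A).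
HB.instance Definition _ (K : numFieldType) (A : banachAlgType K) :=
  GRing.Zmodule_isNzRing.Build (banach_carrier A)
    (@banach_mulA K A) (@banach_mul1l K A) (@banach_mul1r K A)
    (@banach_mulDl K A) (@banach_mulDr K A) (@banach_one_neq0 K A).
HB.instance Definition _ (K : numFieldType) (A : banachAlgType K) :=
  GRing.Lmodule_isLalgebra.Build K (banach_carrier A) (@banach_scaleAl K A).
HB.instance Definition _ (K : numFieldType) (A : banachAlgType K) :=
  GRing.Lalgebra_isAlgebra.Build K (banach_carrier A) (@banach_scaleAr K A).

Record orderedBanachAlgType (R : realType) := OrderedBanachAlgebra {
  oba_algebra :> banachAlgType R[i];
  poscone : set oba_algebra;
  poscone_closed : closed poscone;
  posconeD : forall x y : oba_algebra,
    poscone x -> poscone y -> poscone (x + y);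
  posconeZ : forall (t : R) (x : oba_algebra),
    0 <= t -> poscone x -> poscone (t%:C *: x);
  poscone_pointed : poscone `&` [set x | poscone (- x)] = [set 0];
  poscone1 : poscone 1;
  posconeM : forall x y : oba_algebra,
    poscone x -> poscone y -> poscone (x * y)
}.

Section OrderedBanachAlgebraTheory.
Variables (R : realType) (A : orderedBanachAlgType R).
Implicit Types (a b p q x y : A) (S : set A).

Definition ale x y : Prop := poscone (y - x).

Definition alt x y : Prop := ale x y /\ x <> y.

Definition order_idempotent : set A :=
  [set p | [/\ p * p = p, ale 0 p & ale p 1]].

Definition directed (I : Type) (le : I -> I -> Prop) : Prop :=
  [/\ inhabited I,
      forall i, le i i,
      forall i j k, le i j -> le j k -> le i k
    & forall i j, exists k, le i k /\ le j k].

(* The net [x], with values in [S], is decreasing and its infimum in the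
   ordered set [S] (with the order induced from [A]) is 0. *)
Definition decreases_to0 S (I : Type) (le : I -> I -> Prop) (x : I -> A)
    : Prop :=
  [/\ S 0 /\ forall i, S (x i),
      forall i j, le i j -> ale (x j) (x i),
      forall i, ale 0 (x i)
    & forall c, S c -> (forall i, ale c (x i)) -> ale c 0].

Definition order_continuous a : Prop :=
  poscone a /\
  forall (I : Type) (le : I -> I -> Prop) (p : I -> A),
    directed le -> decreases_to0 order_idempotent le p ->
    decreases_to0 setT le (fun i => p i * a) /\
    decreases_to0 setT le (fun i => a * p i).

Definition irreducible a : Prop :=
  poscone a /\
  forall p, order_idempotent p -> (1 - p) * a * p = 0 -> p = 0 \/ p = 1.

Definition spectrum a : set R[i] :=
  [set l | ~ exists y, (l%:A - a) * y = 1 /\ y * (l%:A - a) = 1].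

(* The norm of [R[i]] takes its (real) values in [R[i]], hence the real part. *)
Definition spectral_radius a : R :=
  sup [set complex.Re `|l| | l in spectrum a].

End OrderedBanachAlgebraTheory.

Definition finite_dimensional (R : realType) (A : orderedBanachAlgType R)
    : Prop :=
  exists (n : nat) (e : 'I_n -> A),
    forall x : A, exists c : 'I_n -> R[i], x = \sum_(i < n) c i *: e i.

Definition disjunctive_product (R : realType) (A : orderedBanachAlgType R)
    : Prop :=
  forall a b : A, order_continuous a -> order_continuous b -> a * b = 0 ->
    exists p : A, [/\ order_idempotent p, a * p = 0 & (1 - p) * b = 0].

(* Main.v *)
Require Import Defs.
From mathcomp Require Import all_boot all_order all_algebra.
From mathcomp Require Import all_classical all_reals all_analysis.
From mathcomp Require Import complex.

Set Implicit Arguments.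
Unset Strict Implicit.
Unset Printing Implicit Defensive.

Import Order.TTheory GRing.Theory Num.Theory.
Import numFieldNormedType.Exports.

Local Open Scope classical_set_scope.
Local Open Scope ring_scope.
Local Open Scope complex_scope.

(** Write r = r(a) and s = r(b).  A Perron-Frobenius theorem ([perron]) provides
    nonzero positive elements u and w with u a = r u and b w = s w.  As a - b is
    positive, so is u (a - b) w = (r - s) u w; if r <= s, its opposite is
    positive too, hence u (a - b) w = 0.

    Irreducibility makes positive eigenelements of a faithful: if u a = r u and
    c >= 0, then u c = 0 forces c = 0 ([irreducible_right_faithful]), and
    symmetrically for a w = s w and c w = 0 ([irreducible_left_faithful]).  The
    first fact gives (a - b) w = 0; then w is an eigenelement of a as well, and
    the second one gives a - b = 0, against b < a.

    Faithfulness comes from supports.  Order idempotents commute, and in finite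
    dimension each family of them that is stable under products has a smallest
    member; so every decreasing net of order idempotents reaches its infimum and
    every positive element is order continuous
    ([positive_order_continuous]).  The disjunctive product thus applies to all
    positive elements, and the smallest order idempotent p with p w = w
    satisfies c p = 0 as soon as c >= 0 and c w = 0 ([left_support]).  When
    a w = s w, the element (1 - p) a p is positive and kills w, so it vanishes;
    irreducibility leaves only p = 1.

    For the Perron-Frobenius theorem, let tau be the infimum of the t for which
    t - b has a positive inverse.  Neumann series extend positivity of the
    resolvent a little to the left of t, by an amount inverse to its norm, so
    the resolvents blow up near tau, and a limit direction of theirs is a
    positive eigenelement for tau.  If t - b has a positive inverse, the powers
    of b / t lie in one order interval, and order intervals are bounded because
    the cone is closed and pointed; hence no spectral value exceeds t in
    modulus, and tau = r(b).

    All compactness is concentrated in [direction_cluster]: real coordinates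
    reduce it to the unit sphere of a space of row vectors. *)

(** * Norms, real coordinates and compactness *)

Section Coordinates.
Variables (R : realType) (A : orderedBanachAlgType R).
Implicit Types x y : A.

(** The norm of A has its real values in R[i]; this is the same norm in R. *)
Definition nrm x : R := complex.Re `|x|.

Lemma nrmE x : (nrm x)%:C = `|x|.
Proof. by rewrite /nrm RRe_real // normr_real. Qed.

Lemma nrm_ge0 x : 0 <= nrm x.
Proof. by rewrite -ler0c nrmE. Qed.

Lemma nrm_eq0 x : nrm x = 0 -> x = 0.
Proof. by move=> h; apply/eqP; rewrite -normr_eq0 -nrmE h. Qed.

Lemma nrmD x y : nrm (x + y) <= nrm x + nrm y.
Proof. by rewrite -lecR rmorphD /= !nrmE ler_normD. Qed.

Lemma nrmN x : nrm (- x) = nrm x.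
Proof. by rewrite /nrm normrN. Qed.

Lemma nrmM x y : nrm (x * y) <= nrm x * nrm y.
Proof. by rewrite -lecR rmorphM /= !nrmE; exact: banach_norm_submult. Qed.

Lemma nrmZ (k : R[i]) x : nrm (k *: x) = complex.Re `|k| * nrm x.
Proof.
rewrite -[LHS]/(complex.Re `|k *: x|) normrZ -nrmE normc_def /=.
by rewrite mul0r subr0.
Qed.

Lemma nrmZr (t : R) x : nrm (t%:C *: x) = `|t| * nrm x.
Proof.
rewrite nrmZ; congr (_ * _); apply: complexI.
by rewrite RRe_real ?normr_real// normc_def /= expr0n addr0 sqrtr_sqr.
Qed.

Lemma nrm0 : nrm 0 = 0.
Proof. by rewrite /nrm normr0. Qed.

Lemma poscone_approx x :
  (forall e : R, 0 < e -> exists y, poscone y /\ nrm (x - y) < e) -> poscone x.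
Proof.
move=> h; apply: poscone_closed => B /nbhs_ballP[e /= e0 eB].
have /RRe_real eE : e \is Num.real by rewrite ger0_real// ltW.
have e0' : 0 < complex.Re e by rewrite -ltcR eE.
have [y [py xy]] := h _ e0'.
exists y; split => //; apply: eB; rewrite -ball_normE /ball_/=.
by rewrite -nrmE -eE ltcR.
Qed.

Definition rcomb n (e : 'I_n -> A) (c : 'rV[R]_n) : A :=
  \sum_i (c 0 i)%:C *: e i.

Lemma rcombB n (e : 'I_n -> A) (c d : 'rV[R]_n) :
  rcomb e (c - d) = rcomb e c - rcomb e d.
Proof.
rewrite /rcomb -sumrB; apply: eq_bigr => i _.
by rewrite !mxE rmorphB scalerBl.
Qed.

Lemma rcombZ n (e : 'I_n -> A) (t : R) (c : 'rV[R]_n) :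
  rcomb e (t *: c) = t%:C *: rcomb e c.
Proof.
rewrite /rcomb scaler_sumr; apply: eq_bigr => i _.
by rewrite !mxE rmorphM scalerA.
Qed.

Lemma rcomb0 n (e : 'I_n -> A) : rcomb e 0 = 0.
Proof. by rewrite -[0 in LHS](subrr 0) rcombB subrr. Qed.

Lemma nrm_rcomb n (e : 'I_n -> A) (c : 'rV[R]_n) :
  nrm (rcomb e c) <= `|c| * \sum_i nrm (e i).
Proof.
have le_sum (s : seq 'I_n) (F : 'I_n -> A) :
    nrm (\sum_(i <- s) F i) <= \sum_(i <- s) nrm (F i).
  elim: s => [|i s ih]; first by rewrite !big_nil nrm0.
  by rewrite !big_cons (le_trans (nrmD _ _))// lerD2l.
rewrite (le_trans (le_sum _ _))// mulr_sumr ler_sum// => i _.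
rewrite nrmZr ler_wpM2r ?nrm_ge0//.
rewrite [leRHS]/Num.norm /= mx_normrE; apply/bigmax_geP; right => /=.
by exists (0, i).
Qed.

(** Real coordinates, so that compactness of spheres over R applies: real and
    imaginary parts make the given family span over R, and a real spanning
    family of least size is free. *)
Lemma real_frame : finite_dimensional A ->
  exists n (e : 'I_n -> A), (forall x, exists c, x = rcomb e c) /\
    (forall c, rcomb e c = 0 -> c = 0).
Proof.
move=> [n0 [e0 he0]].
pose P n := `[< exists e : 'I_n -> A, forall x, exists c, x = rcomb e c >].
have exP : exists n, P n.
  exists (n0 + n0)%N; apply/asboolP.
  (* the second half of the family is multiplied by the imaginary unit *)
  exists (fun i => match fintype.split i with
                   | inl j => e0 j | inr j => 'i *: e0 j end).
  move=> x; have [c ->] := he0 x.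
  exists (\row_i match fintype.split i with inl j => complex.Re (c j)
                               | inr j => complex.Im (c j) end).
  rewrite /rcomb big_split_ord /= -big_split /=; apply: eq_bigr => i _.
  rewrite !mxE.
  rewrite (unsplitK (inl i : 'I_n0 + 'I_n0)) (unsplitK (inr i : 'I_n0 + 'I_n0)).
  by rewrite scalerA -scalerDl mulrC -complexE.
case: (ex_minnP exP) => n /asboolP[e he] nmin.
exists n, e; split => // c c0; apply/eqP; apply: contraT => cn0.
case: n e he nmin c c0 cn0 => [|n] e he nmin c c0 cn0.
  by rewrite thinmx0 eqxx in cn0.
have [j cj] : exists j, c 0 j != 0.
  apply/existsP; apply: contraT; rewrite negb_exists => /forallP h.
  move: cn0; apply: contraNT => _; apply/eqP/rowP => j.
  by have := h j; rewrite negbK mxE => /eqP.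
(* otherwise e j is a combination of the others, and can be dropped *)
suff : P n by move=> /nmin; rewrite ltnn.
apply/asboolP; exists (e \o lift j) => x; have [d ->] := he x.
pose d' := d - (d 0 j / c 0 j) *: c.
exists (\row_k d' 0 (lift j k)).
have -> : rcomb e d = rcomb e d' by rewrite rcombB rcombZ c0 scaler0 subr0.
have d'j : d' 0 j = 0 by rewrite /d' !mxE divfK// subrr.
rewrite /rcomb (bigD1_ord j)//= d'j scale0r add0r.
by apply: eq_bigr => k _; rewrite !mxE.
Qed.

Lemma sphere_cluster n (z : nat -> 'rV[R]_n) : (forall k, `|z k| = 1) ->
  exists u, `|u| = 1 /\
    forall (e : R) N, 0 < e -> exists k, (N <= k)%N /\ `|u - z k| < e.
Proof.
move=> z1.
have cS : compact [set v : 'rV[R]_n | `|v| = 1].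
  apply: bounded_closed_compact.
    exists 1; split => // M M1 v /= ->; exact: ltW.
  have := @preimage_closed _ _ (fun v : 'rV[R]_n => `|v|) [set 1].
  apply; last exact: closed_eq.
  by move=> v _; exact: norm_continuous.
have [|y [/= y1 yc]] := cS (z @ \oo) _.
  by exists 0%N => // k _ /=.
exists y; split => // e N e0.
have [] := yc (z @` [set k | (N <= k)%N]) (ball y e).
- by exists N => // k /= Nk; exists k.
- exact: nbhsx_ballx.
by move=> _ [[k /= Nk <-]]; rewrite -ball_normE /= => ?; exists k.
Qed.

(** Bolzano-Weierstrass for directions.  The scalars s k are inverse norms of
    coordinate vectors rather than of the x k: then z <> 0 needs only the
    injectivity of coordinates, while the inequality with C still says that
    s k is small when x k is large, so norms need not be shown equivalent. *)
Lemma direction_cluster : finite_dimensional A ->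
  exists C : R, forall x : nat -> A, (forall k, x k <> 0) ->
  exists (s : nat -> R) (z : A),
  [/\ forall k, 0 < s k, forall k, s k * nrm (x k) <= C, z <> 0
    & forall (e : R) N, 0 < e ->
        exists k, (N <= k)%N /\ nrm (z - (s k)%:C *: x k) < e].
Proof.
move=> /real_frame [n [e [he inj]]].
set C := \sum_i nrm (e i).
have C0 : 0 <= C by apply: sumr_ge0 => i _; exact: nrm_ge0.
exists C => x x0.
have [c hc] := choice (fun k => he (x k)).
have c0 k : 0 < `|c k|.
  rewrite normr_gt0; apply/eqP => ck0; apply: (x0 k).
  by rewrite hc ck0 rcomb0.
have [|y [y1 yc]] := sphere_cluster (z := fun k => `|c k|^-1 *: c k).
  by move=> k; rewrite normrZ normfV normr_id mulVf// gt_eqF.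
exists (fun k => `|c k|^-1), (rcomb e y); split.
- by move=> k; rewrite invr_gt0.
- by move=> k; rewrite mulrC ler_pdivrMr// mulrC hc nrm_rcomb.
- move=> /inj y0; move: y1.
  by rewrite y0 normr0 => /eqP; rewrite eq_sym oner_eq0.
move=> d N d0; have C1 : 0 < C + 1 by rewrite ltr_wpDl.
have [k [Nk yk]] := yc (d / (C + 1)) N (divr_gt0 d0 C1).
exists k; split => //; rewrite [X in _ *: X]hc -rcombZ -rcombB.
rewrite (le_lt_trans (nrm_rcomb _ _))// -/C.
have [->|Cn0] := eqVneq C 0; first by rewrite mulr0.
have Cp : 0 < C by rewrite lt0r Cn0.
rewrite (@lt_le_trans _ _ (d / (C + 1) * C))// ?ltr_pM2r//.
by rewrite mulrAC ler_pdivrMr// ler_wpM2l ?ltW// ltrDl.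
Qed.

End Coordinates.

(** * The left regular representation *)

Section LeftRegular.
Variables (R : realType) (A : orderedBanachAlgType R).
Hypothesis hfin : finite_dimensional A.
Implicit Types x y c p q : A.

Lemma left_regular_matrix :
  exists n (co : A -> 'rV[R]_n) (de : 'rV[R]_n -> A) (L : A -> 'M[R]_n),
  [/\ cancel co de, cancel de co, co 0 = 0
    & forall c x, co (c * x) = co x *m L c].
Proof.
have [n [e [he inj]]] := real_frame hfin.
have [co coE] := choice he.
have deK : cancel (rcomb e) co.
  by move=> v; apply/eqP; rewrite -subr_eq0; apply/eqP/inj;
    rewrite rcombB -coE subrr.
exists n, co, (rcomb e), (fun c => \matrix_i co (c * e i)); split => //.
  by rewrite -(rcomb0 e) deK.
move=> c x; rewrite -[RHS]deK; congr co.
rewrite [in LHS](coE x) /rcomb mulr_sumr.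
under [RHS]eq_bigr do rewrite mxE rmorph_sum scaler_suml.
rewrite exchange_big /=; apply: eq_bigr => i _.
rewrite -scalerAr [c * e i]coE /rcomb scaler_sumr.
by apply: eq_bigr => j _; rewrite scalerA -rmorphM !mxE.
Qed.

Lemma invertible_of_injective c : (forall x, c * x = 0 -> x = 0) ->
  exists y, c * y = 1 /\ y * c = 1.
Proof.
have [n [co [de [L [coK deK co0 coL]]]]] := left_regular_matrix.
move=> cinj.
have Lu : L c \in unitmx.
  rewrite -row_free_unit -kermx_eq0; apply/eqP/row_matrixP => i.
  rewrite row0; have /sub_kermxP h := row_sub i (kermx (L c)).
  rewrite -[LHS]deK [de _]cinj// -[LHS]coK coL deK h.
  by rewrite -co0 coK.
exists (de (co 1 *m invmx (L c))).
have cy : c * de (co 1 *m invmx (L c)) = 1.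
  by rewrite -[LHS]coK coL deK mulmxKV// coK.
split => //; apply/eqP; rewrite -subr_eq0; apply/eqP/cinj.
by rewrite mulrBr mulrA cy mul1r mulr1 subrr.
Qed.

(** The rank of left multiplication by p is a length function: multiplying p
    by an idempotent that commutes with it either fixes p or lowers the rank. *)
Lemma rank_of_idempotent : exists rk : A -> nat, forall p q,
  q * q = q -> p * q = q * p -> (rk p <= rk (p * q)%R)%N -> p * q = p.
Proof.
have [n [co [de [L [coK deK co0 coL]]]]] := left_regular_matrix.
have LM p q : L (p * q) = L q *m L p.
  apply/row_matrixP => i; rewrite !rowE.
  by rewrite -[delta_mx _ _]deK -coL -mulrA !coL mulmxA.
exists (fun p => \rank (L p)) => p q qq pq rk.
have le : (L (p * q)%R <= L p)%MS by rewrite LM submxMl.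
have /submxP[D DE] : (L p <= L (p * q)%R)%MS.
  by have := mxrank_leqif_sup le; case => le' <-; rewrite eqn_leq le' rk.
rewrite pq -[LHS]coK -[RHS]coK; congr de.
rewrite coL -[p]mulr1 coL DE pq LM -!mulmxA; congr (_ *m (_ *m (_ *m _))).
by rewrite -LM qq.
Qed.
End LeftRegular.

(** * Positive resolvents and the Perron-Frobenius theorem *)

Lemma exp_small (R : realType) (M q e : R) : 0 <= M -> 0 <= q < 1 -> 0 < e ->
  exists k, M * q ^+ k < e.
Proof.
move=> M0 /andP[q0 q1] e0.
have M1 : 0 < M + 1 by rewrite ltr_wpDl.
have /cvg_expr : `|q| < 1 by rewrite ger0_norm.
move=> /cvgr0Pnorm_lt /(_ _ (divr_gt0 e0 M1)) [k _ /(_ k (leqnn k)) /=].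
rewrite ger0_norm ?exprn_ge0// ltr_pdivlMr// mulrC => h.
by exists k; apply: le_lt_trans h; rewrite ler_wpM2r ?exprn_ge0// lerDl.
Qed.

Lemma exp_unbounded (R : realType) (M q : R) :
  (forall k, q ^+ k <= M) -> q <= 1.
Proof.
move=> h; rewrite leNgt; apply/negP => q1.
have q0 : 0 < q by apply: lt_trans q1.
have M0 : 0 < M by rewrite (lt_le_trans _ (h 0%N)).
have [|k] := exp_small (ltW M0) _ ltr01 (q := q^-1).
  by rewrite invr_ge0 ltW//= invf_lt1.
rewrite exprVn ltr_pdivrMr ?exprn_gt0// mul1r ltNge.
by rewrite h.
Qed.

Section Cone.
Variables (R : realType) (A : orderedBanachAlgType R).
Implicit Types x y z b c : A.

Lemma poscone0 : poscone (0 : A).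
Proof.
by rewrite -(scale0r 1); apply: (@posconeZ _ A 0) => //; exact: poscone1.
Qed.

Lemma poscone_anti x : poscone x -> poscone (- x) -> x = 0.
Proof.
move=> px nx; have : (@poscone _ A `&` [set x | poscone (- x)]) x by [].
by rewrite poscone_pointed.
Qed.

Lemma posconeX b k : poscone b -> poscone (b ^+ k).
Proof.
move=> pb; elim: k => [|k ih]; first by rewrite expr0; exact: poscone1.
by rewrite exprS; exact: posconeM.
Qed.

Lemma poscone_sum n (F : nat -> A) : (forall i, poscone (F i)) ->
  poscone (\sum_(i < n) F i).
Proof.
move=> pF; elim/big_ind: _ => // [|x y]; [exact: poscone0 | exact: posconeD].
Qed.

Lemma nrmMX x c k : nrm (x * c ^+ k) <= nrm x * nrm c ^+ k.
Proof.
elim: k => [|k ih]; first by rewrite !expr0 !mulr1.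
rewrite !exprSr mulrA (le_trans (nrmM _ _))// mulrA.
by rewrite ler_wpM2r ?nrm_ge0.
Qed.

Section FiniteDimensional.
Hypothesis hfin : finite_dimensional A.

(** The inverse exists by finite dimension, as 1 - c is injective; the partial
    sums of the Neumann series serve only to show that it is positive. *)
Lemma neumann c : poscone c -> nrm c < 1 ->
  exists y, [/\ poscone y, (1 - c) * y = 1 & y * (1 - c) = 1].
Proof.
move=> pc c1.
have [x|y [cy yc]] := @invertible_of_injective _ _ hfin (1 - c).
  rewrite mulrBl mul1r => /eqP; rewrite subr_eq0 => /eqP xE.
  apply: nrm_eq0; apply/eqP; rewrite eq_le nrm_ge0 andbT leNgt.
  apply/negP => x0; have := nrmM c x; rewrite -xE.
  by rewrite leNgt gtr_pMl// c1.
exists y; split => //; apply: poscone_approx => e e0.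
have [|k hk] := exp_small (nrm_ge0 y) _ e0 (q := nrm c).
  by rewrite nrm_ge0.
exists (\sum_(i < k) c ^+ i); split.
  by apply: (@poscone_sum k (fun i => c ^+ i)) => i; exact: posconeX.
have -> : y - \sum_(i < k) c ^+ i = y * c ^+ k.
  have : (1 - c) * \sum_(i < k) c ^+ i = 1 - c ^+ k.
    by rewrite -[LHS]opprK -mulNr opprB -subrX1 opprB.
  move=> /(congr1 (fun x => y * x)).
  by rewrite mulrA yc mul1r => ->; rewrite mulrBr mulr1 opprB addrC subrK.
exact: le_lt_trans (nrmMX _ _ _) hk.
Qed.

Definition pos_resolvent b (t : R) y :=
  [/\ poscone y, (t%:C%:A - b) * y = 1 & y * (t%:C%:A - b) = 1].

Lemma pos_resolvent_large b t : poscone b -> nrm b < t ->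
  exists y, pos_resolvent b t y.
Proof.
move=> pb bt; have t0 : 0 < t by apply: le_lt_trans bt; exact: nrm_ge0.
have tC : t%:C != 0 by rewrite (inj_eq (@complexI _) t 0) gt_eqF.
have ti : 0 <= t^-1 by rewrite invr_ge0 ltW.
have [||y [py cy yc]] := @neumann ((t^-1)%:C *: b).
- exact: posconeZ.
- by rewrite nrmZr ger0_norm// mulrC ltr_pdivrMr// mul1r.
have E : t%:C%:A - b = t%:C *: (1 - (t^-1)%:C *: b).
  by rewrite scalerBr scalerA -rmorphM divff ?gt_eqF// scale1r.
exists ((t^-1)%:C *: y); split; first exact: posconeZ.
- by rewrite E -scalerAr -scalerAl scalerA -rmorphM mulVf ?gt_eqF// scale1r.
- by rewrite E -scalerAr -scalerAl scalerA -rmorphM divff ?gt_eqF// scale1r.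
Qed.

(** (t - d) - b = (t - b) (1 - d y), and the second factor has a positive
    inverse. *)
Lemma pos_resolvent_left b t y d : pos_resolvent b t y -> 0 <= d ->
  d * nrm y < 1 -> exists z, pos_resolvent b (t - d) z.
Proof.
move=> [py by1 yb1] d0 dy.
have [||z [pz cz zc]] := @neumann (d%:C *: y).
- exact: posconeZ.
- by rewrite nrmZr ger0_norm.
have E : (t - d)%:C%:A - b = (t%:C%:A - b) * (1 - d%:C *: y).
  by rewrite mulrBr mulr1 -scalerAr by1 rmorphB scalerBl addrAC.
exists (z * y); split; first exact: posconeM.
- by rewrite E -mulrA (mulrA _ z) cz mul1r.
- by rewrite E -mulrA (mulrA y) yb1 mul1r.
Qed.

(** If t <= 0, then 1 = t y - b y would be both positive and negative. *)
Lemma pos_resolvent_gt0 b t y : poscone b -> pos_resolvent b t y -> 0 < t.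
Proof.
move=> pb [py by1 _]; rewrite ltNge; apply/negP => t0.
have /eqP := oner_neq0 A; apply; apply: poscone_anti; first exact: poscone1.
rewrite -by1 -mulNr opprB mulrBl -scalerAl mul1r -scaleNr -rmorphN.
apply: posconeD; first exact: posconeM.
by apply: posconeZ => //; rewrite oppr_ge0.
Qed.

(** Heuristically y is the sum of the series of the b^k / t^(k+1), which
    dominates each term; iterating t y = 1 + b y gives this without any
    convergence. *)
Lemma power_le_resolvent b t y k : poscone b -> pos_resolvent b t y ->
  ale (b ^+ k) ((t ^+ k.+1)%:C *: y).
Proof.
move=> pb res; have t0 := pos_resolvent_gt0 pb res.
have [py by1 _] := res.
have tyE : t%:C *: y = 1 + b * y.
  by rewrite -by1 mulrBl -scalerAl mul1r subrK.
rewrite /ale; elim: k => [|k ih].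
  by rewrite expr1 expr0 tyE addrAC subrr add0r; exact: posconeM.
rewrite exprSr rmorphM -scalerA tyE scalerDr scalerAr [b ^+ _]exprS.
rewrite -addrA -mulrBr.
apply: posconeD; last exact: posconeM.
by apply: posconeZ; [rewrite exprn_ge0// ltW | exact: poscone1].
Qed.

(** Normality of the cone.  If 0 <= x k <= y with x k unbounded, a limit
    direction z of the x k satisfies 0 <= z <= 0, since y is negligible
    compared with x k. *)
Lemma order_interval_bounded y :
  exists M, forall x, poscone x -> ale x y -> nrm x <= M.
Proof.
apply: contrapT => h.
have far (k : nat) : exists x, [/\ poscone x, ale x y & k%:R < nrm x].
  apply: contrapT => h'; apply: h; exists k%:R => x px xy.
  by rewrite leNgt; apply/negP => kx; apply: h'; exists x.
have [x hx] := choice far.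
have [C hC] := direction_cluster hfin.
have [|s [z [s0 sC z0 zc]]] := hC x.
  move=> k xk; have [_ _] := hx k.
  by rewrite xk nrm0 ltNge ler0n.
have C0 : 0 <= C by apply: le_trans (sC 0%N); rewrite mulr_ge0 ?nrm_ge0// ltW.
apply: z0; apply: poscone_anti.
  apply: poscone_approx => e /(zc e 0%N) [k [_ zk]].
  exists ((s k)%:C *: x k); split => //.
  by apply: posconeZ; [exact: ltW | case: (hx k)].
apply: poscone_approx => e e0.
have e2 : 0 < e / 2 by rewrite divr_gt0.
have [N hN] : exists N : nat, (C * nrm y) / (e / 2) < N%:R.
  by exists (Num.truncn (C * nrm y / (e / 2))).+1; exact: truncnS_gt.
have [k [Nk zk]] := zc _ N.+1 e2.
exists ((s k)%:C *: (y - x k)); split.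
  by apply: posconeZ; [exact: ltW | case: (hx k)].
have -> : - z - (s k)%:C *: (y - x k)
    = - (z - (s k)%:C *: x k) + - ((s k)%:C *: y).
  by rewrite scalerBr !opprB addrA (addrC (- z)).
rewrite (le_lt_trans (nrmD _ _))// !nrmN (splitr e) ltrD// nrmZr.
rewrite ger0_norm ?ltW//.
have k0 : (0 : R) < k%:R by rewrite ltr0n (leq_trans _ Nk).
have skC : s k * k%:R <= C.
  apply: le_trans (sC k); apply: ler_wpM2l; first exact: ltW.
  by case: (hx k) => _ _ /ltW.
have : s k * nrm y * k%:R <= C * nrm y.
  by rewrite mulrAC ler_wpM2r ?nrm_ge0.
have : C * nrm y < k%:R * (e / 2).
  by rewrite -ltr_pdivrMr// (lt_le_trans hN)// ler_nat ltnW.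
move=> h1 h2; rewrite -(ltr_pM2r k0) (mulrC (e / 2)); exact: le_lt_trans h2 h1.
Qed.

Lemma spectrum_eigenvector b l : spectrum b l ->
  exists2 v, v <> 0 & b * v = l *: v.
Proof.
move=> bl; apply: contrapT => h; apply: bl.
apply: invertible_of_injective => // v /eqP.
rewrite mulrBl -scalerAl mul1r subr_eq0 => /eqP E.
by apply: contrapT => v0; apply: h; exists v.
Qed.

(** The powers of b / t are bounded, and act on an eigenvector for l as the
    powers of l / t. *)
Lemma spectrum_le b l t y : poscone b -> pos_resolvent b t y ->
  spectrum b l -> complex.Re `|l| <= t.
Proof.
move=> pb res /spectrum_eigenvector [v v0 bv].
have t0 := pos_resolvent_gt0 pb res.
have nv : 0 < nrm v.
  by rewrite lt_neqAle nrm_ge0 andbT; apply/eqP => /esym/nrm_eq0.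
have [M hM] := order_interval_bounded (t%:C *: y).
rewrite -[leRHS]mul1r -ler_pdivrMr//.
apply: (@exp_unbounded _ M) => k.
have tk : 0 <= t ^- k by rewrite invr_ge0 exprn_ge0 ?(ltW t0).
have bound : nrm (((t ^- k)%:C) *: b ^+ k) <= M.
  apply: hM; first by apply: posconeZ => //; exact: posconeX.
  have := power_le_resolvent k pb res => /(posconeZ tk).
  rewrite scalerBr scalerA -rmorphM exprS mulrCA mulVf ?mulr1//.
  by rewrite expf_neq0 ?gt_eqF.
apply: le_trans bound; rewrite nrmZr [`|t ^- k|]ger0_norm//.
rewrite expr_div_n mulrC ler_wpM2l//.
rewrite -(ler_pM2r nv); apply: le_trans (nrmM _ _).
suff -> : b ^+ k * v = l ^+ k *: v.
  rewrite nrmZ ler_wpM2r ?nrm_ge0// normrX.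
  rewrite -[in leRHS](RRe_real (normr_real l)) -rmorphXn.
  exact: lexx.
elim: k {tk} => [|k ih]; first by rewrite !expr0 mul1r scale1r.
by rewrite !exprS -mulrA ih -scalerAr bv scalerA mulrC.
Qed.

(** The eigenvalue tau is the infimum of the t with a positive resolvent: it is
    in the spectrum, and bounds it by [spectrum_le]. *)
Lemma perron b : poscone b -> exists w,
  [/\ poscone w, w <> 0, b * w = (spectral_radius b)%:C *: w
    & w * b = (spectral_radius b)%:C *: w].
Proof.
move=> pb.
pose P := [set t : R | exists y, pos_resolvent b t y].
have P0 : lbound P 0.
  by move=> t [y res]; exact/ltW/(pos_resolvent_gt0 pb res).
have hP : has_inf P.
  split; last by exists 0.
  exists (nrm b + 1); apply: pos_resolvent_large => //; by rewrite ltrDl.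
pose tau := inf P.
have tau0 : 0 <= tau by apply: lb_le_inf => //; case: hP.
have near_tau (k : nat) : exists ty : R * A,
    [/\ pos_resolvent b ty.1 ty.2, tau <= ty.1,
      ty.1 < tau + k.+1%:R^-1 & k.+1%:R <= nrm ty.2].
  have k0 : (0 : R) < k.+1%:R^-1 by rewrite invr_gt0.
  have [t Pt tt] := inf_adherent k0 hP.
  have [y res] := Pt.
  exists (t, y); split => //=.
    by apply: ge_inf => //; exists 0.
  (* a resolvent of norm below k + 1 would extend to the left of tau *)
  rewrite leNgt; apply/negP => yk.
  have [|z resz] := pos_resolvent_left res (ltW k0).
    by rewrite mulrC ltr_pdivrMr// mul1r.
  have : tau <= t - k.+1%:R^-1 by apply: ge_inf; [exists 0 | exists z].
  by rewrite lerBrDr leNgt tt.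
have [ty hty] := choice near_tau.
have [C hC] := direction_cluster hfin.
have [|s [z [s0 sC z0 zc]]] := hC (fun k => (ty k).2).
  move=> k yk; have [_ _ _] := hty k.
  by rewrite yk nrm0 leNgt ltr0n.
have C0 : 0 <= C by apply: le_trans (sC 0%N); rewrite mulr_ge0 ?nrm_ge0// ltW.
have pz : poscone z.
  apply: poscone_approx => e /(zc e 0%N) [k [_ zk]].
  exists ((s k)%:C *: (ty k).2); split => //.
  by apply: posconeZ; [exact: ltW | case: (hty k) => -[]].
(* f stands for left or right multiplication by tau - b; it maps the resolvent
   at t to 1 + (tau - t) times itself, which is negligible after scaling *)
have eig (f : A -> A) (D : R) : 0 <= D -> (forall x y, f (x - y) = f x - f y) ->
    (forall (t : R) x, f (t%:C *: x) = t%:C *: f x) ->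
    (forall x, nrm (f x) <= D * nrm x) ->
    (forall k, f (ty k).2 = 1 + (tau - (ty k).1)%:C *: (ty k).2) -> f z = 0.
  move=> D0 fB fZ fD fy; apply: nrm_eq0; apply/eqP.
  rewrite eq_le nrm_ge0 andbT leNgt; apply/negP => fz0.
  have [N hN] : exists N : nat, (D + C * nrm (1 : A) + C) / nrm (f z) < N%:R.
    exists (Num.truncn ((D + C * nrm (1 : A) + C) / nrm (f z))).+1.
    exact: truncnS_gt.
  have N0 : (0 : R) < N.+1%:R by [].
  have [k [Nk zk]] := zc N.+1%:R^-1 N (etrans (invr_gt0 _) N0).
  have [res t1 t2 yk] := hty k.
  have kN : k.+1%:R^-1 <= N.+1%:R^-1 :> R by rewrite lef_pV2 ?posrE// ler_nat.
  have sk : s k <= C * N.+1%:R^-1.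
    rewrite (@le_trans _ _ (C * k.+1%:R^-1))// ?ler_wpM2l//.
    rewrite ler_pdivlMr//; apply: le_trans (sC k).
    by rewrite ler_wpM2l// ltW.
  have : nrm (f z) <= (D + C * nrm (1 : A) + C) * N.+1%:R^-1.
    have -> : f z = f (z - (s k)%:C *: (ty k).2)
        + ((s k)%:C *: 1 + (s k)%:C *: ((tau - (ty k).1)%:C *: (ty k).2)).
      by rewrite -scalerDr -fy -fZ fB subrK.
    rewrite 2!mulrDl -addrA; apply: (le_trans (nrmD _ _)).
    apply: lerD.
      by apply: le_trans (fD _) _; rewrite ler_wpM2l// ltW.
    apply: (le_trans (nrmD _ _)); apply: lerD.
      by rewrite nrmZr (ger0_norm (ltW (s0 k))) mulrAC ler_wpM2r ?nrm_ge0.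
    rewrite !nrmZr (ger0_norm (ltW (s0 k))) mulrCA mulrC distrC.
    rewrite ger0_norm ?subr_ge0//; apply: ler_pM => //.
    - by rewrite mulr_ge0 ?nrm_ge0// (ltW (s0 k)).
    - by rewrite subr_ge0.
    apply: ltW; rewrite ltrBlDl; apply: lt_le_trans t2 _; by rewrite lerD2l.
  rewrite ler_pdivlMr// leNgt (mulrC (nrm (f z))) => /negP; apply.
  by rewrite -ltr_pdivrMr// (lt_trans hN)// ltr_nat.
have D0 : 0 <= tau + nrm b by rewrite addr_ge0 ?nrm_ge0.
have bz : b * z = tau%:C *: z.
  apply/esym/eqP; rewrite -subr_eq0; apply/eqP.
  apply: (eig (fun x => tau%:C *: x - b * x) _ D0).
  - by move=> x y; rewrite scalerBr mulrBr !opprD !opprK [RHS]addrACA.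
  - by move=> t x; rewrite scalerBr -scalerAr scalerA mulrC -scalerA.
  - move=> x; rewrite (le_trans (nrmD _ _))// nrmN nrmZr ger0_norm// mulrDl.
    by rewrite lerD2l nrmM.
  - move=> k; have [[_ by1 _] _ _ _] := hty k.
    rewrite -by1 mulrBl -scalerAl mul1r rmorphB scalerBl.
    by rewrite addrAC addrCA subrr addr0.
have zb : z * b = tau%:C *: z.
  apply/esym/eqP; rewrite -subr_eq0; apply/eqP.
  apply: (eig (fun x => tau%:C *: x - x * b) _ D0).
  - by move=> x y; rewrite scalerBr mulrBl !opprD !opprK [RHS]addrACA.
  - by move=> t x; rewrite scalerBr -scalerAl scalerA mulrC -scalerA.
  - move=> x; rewrite (le_trans (nrmD _ _))// nrmN nrmZr ger0_norm// mulrDl.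
    by rewrite lerD2l mulrC nrmM.
  - move=> k; have [[_ _ yb1] _ _ _] := hty k.
    rewrite -yb1 mulrBr -scalerAr mulr1 rmorphB scalerBl.
    by rewrite addrAC addrCA subrr addr0.
suff -> : spectral_radius b = tau by exists z.
have tau_in : [set complex.Re `|l| | l in spectrum b] tau.
  exists tau%:C.
    move=> [y [_ yb]]; apply: z0.
    by rewrite -(mul1r z) -yb -mulrA mulrBl -scalerAl mul1r bz subrr mulr0.
  apply: complexI; rewrite RRe_real ?normr_real//.
  by rewrite ger0_norm// ler0c.
have tau_ub : ubound [set complex.Re `|l| | l in spectrum b] tau.
  move=> _ [l bl <-]; apply: lb_le_inf; first by case: hP.
  by move=> t [y res]; exact: spectrum_le pb res bl.
apply/eqP; rewrite eq_le; apply/andP; split.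
  by apply: sup_le_ub => //; exists tau.
by apply: ub_le_sup => //; exists tau.
Qed.

End FiniteDimensional.
End Cone.

(** * Order idempotents *)

Section OrderIdempotents.
Variables (R : realType) (A : orderedBanachAlgType R).
Implicit Types a c u w p q : A.
Local Notation OI := (@order_idempotent R A).

Lemma ale0 a : ale 0 a <-> poscone a.
Proof. by rewrite /ale subr0. Qed.

Lemma order_idempotent1 : OI 1.
Proof.
split; rewrite ?mulr1// ?ale0; first exact: poscone1.
by rewrite /ale subrr; exact: poscone0.
Qed.

Lemma order_idempotentC p : OI p -> OI (1 - p).
Proof.
move=> [pp /ale0 p0 p1]; split.
- by rewrite mulrBr mulr1 mulrBl mul1r pp subrr subr0.
- exact/ale0.
- by rewrite /ale opprB addrC subrK.
Qed.

(** 0 <= q <= 1 gives 0 <= (1 - p) q p <= (1 - p) p = 0. *)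
Lemma order_idempotent_corner p q : OI p -> OI q -> (1 - p) * q * p = 0.
Proof.
move=> [pp /ale0 p0 p1] [_ /ale0 q0 q1].
apply: poscone_anti; first by apply: posconeM => //; exact: posconeM.
have -> : - ((1 - p) * q * p) = (1 - p) * (1 - q) * p.
  rewrite (mulrBr (1 - p)) mulr1 (mulrBl p (1 - p)) (mulrBl p 1) mul1r.
  by rewrite pp subrr sub0r.
by apply: posconeM => //; exact: posconeM.
Qed.

Lemma order_idempotent_comm p q : OI p -> OI q -> p * q = q * p.
Proof.
move=> Ip Iq; have Ip' := order_idempotentC Ip.
have := order_idempotent_corner Ip Iq.
have := order_idempotent_corner Ip' Iq.
rewrite subKr mulrBr mulr1 => /eqP; rewrite subr_eq0 => /eqP ->.
by rewrite !mulrBl mul1r => /eqP; rewrite subr_eq0 => /eqP ->.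
Qed.

Lemma order_idempotentM p q : OI p -> OI q -> OI (p * q).
Proof.
move=> Ip Iq; have pq := order_idempotent_comm Ip Iq.
have [[pp /ale0 p0 p1] [qq /ale0 q0 q1]] := (Ip, Iq); split.
- by rewrite -mulrA (mulrA q) -pq -mulrA qq mulrA pp.
- by apply/ale0/posconeM.
- rewrite /ale; have -> : 1 - p * q = (1 - p) + p * (1 - q).
    by rewrite mulrBr mulr1 addrA subrK.
  by apply: posconeD => //; exact: posconeM.
Qed.

Lemma order_idempotent_le p q : OI p -> OI q -> ale p q -> q * p = p.
Proof.
move=> Ip Iq pq; rewrite (order_idempotent_comm Iq Ip).
have [[_ /ale0 p0 _] [qq /ale0 q0 q1]] := (Ip, Iq).
apply/esym/eqP; rewrite -subr_eq0 -{1}[p]mulr1 -mulrBr; apply/eqP.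
apply: poscone_anti; first exact: posconeM.
have -> : - (p * (1 - q)) = (q - p) * (1 - q).
  by rewrite mulrBl (mulrBr q) mulr1 qq subrr sub0r.
exact: posconeM.
Qed.

Section FiniteDimensional.
Hypothesis hfin : finite_dimensional A.

(** Take f i of least rank. *)
Lemma minimal_idempotent (I : Type) (f : I -> A) : I ->
  (forall i, OI (f i)) ->
  exists i, forall q, OI q -> (exists k, f k = f i * q) -> f i * q = f i.
Proof.
move=> i0 If; have [rk hrk] := rank_of_idempotent hfin.
have exP : exists n, `[< exists i, rk (f i) = n >].
  by exists (rk (f i0)); apply/asboolP; exists i0.
case: (ex_minnP exP) => n /asboolP[i <-] imin.
exists i => q Iq [k fk]; apply: hrk.
- by case: Iq.
- exact: order_idempotent_comm.
- by apply: imin; apply/asboolP; exists k; rewrite fk.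
Qed.

(** A member p i of the net that no later member can lower is below all of them
    because the net is directed, so it is the infimum 0; the nets obtained by
    multiplying by a then contain 0. *)
Lemma positive_order_continuous a : poscone a -> order_continuous a.
Proof.
move=> pa; split => // I le p [[i0] _ _ dir] [[_ Ip] dec p0 inf].
have [i imin] := minimal_idempotent i0 Ip.
have pi0 : p i = 0.
  apply: poscone_anti; first exact/ale0.
  have : ale (p i) 0.
    apply: inf => // j; have [k [ik jk]] := dir i j.
    suff -> : p i = p k by exact: dec.
    have pik := order_idempotent_le (Ip k) (Ip i) (dec _ _ ik).
    by rewrite -pik imin//; exists k.
  by rewrite /ale sub0r.
have pp j : poscone (p j) by exact/ale0.
split; split => //.
- by move=> j k jk; rewrite /ale -mulrBl; apply: posconeM => //; exact: dec.
- by move=> j; apply/ale0/posconeM.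
- by move=> c _ /(_ i); rewrite pi0 mul0r.
- by move=> j k jk; rewrite /ale -mulrBr; apply: posconeM => //; exact: dec.
- by move=> j; apply/ale0/posconeM.
- by move=> c _ /(_ i); rewrite pi0 mulr0.
Qed.

Hypothesis hdisj : disjunctive_product A.

Lemma disjunctive_product_pos a c : poscone a -> poscone c -> a * c = 0 ->
  exists p, [/\ OI p, a * p = 0 & (1 - p) * c = 0].
Proof. by move=> pa pc; apply: hdisj; exact: positive_order_continuous. Qed.

(** The smallest order idempotent p with p u = u: if c u = 0, the disjunctive
    product yields another one, q, with c q = 0, and p = p q. *)
Lemma left_support u : poscone u -> exists p, [/\ OI p, p * u = u
  & forall c, poscone c -> c * u = 0 -> c * p = 0].
Proof.
move=> pu.
pose S := {q : A | OI q /\ q * u = u}.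
have s0 : S by exists 1; split; [exact: order_idempotent1 | rewrite mul1r].
have [|[p [Ip pu']] /= pmin] := @minimal_idempotent S sval s0.
  by move=> [q []].
exists p; split => // c pc cu.
have [q [Iq cq qu]] := disjunctive_product_pos pc pu cu.
have qu' : q * u = u.
  by apply/esym/eqP; rewrite -subr_eq0 -{1}[u]mul1r -mulrBl qu.
have Ipq := order_idempotentM Ip Iq.
have pqu : p * q * u = u by rewrite -mulrA qu'.
have <- : p * q = p.
  by apply: pmin => //; exists (exist _ (p * q) (conj Ipq pqu)).
by rewrite (order_idempotent_comm Ip Iq) mulrA cq mul0r.
Qed.

(** Here the disjunctive product puts the complement of q, rather than q itself,
    among the order idempotents that fix u. *)
Lemma right_support u : poscone u -> exists p, [/\ OI p, u * p = u
  & forall c, poscone c -> u * c = 0 -> p * c = 0].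
Proof.
move=> pu.
pose S := {q : A | OI q /\ u * q = u}.
have s0 : S by exists 1; split; [exact: order_idempotent1 | rewrite mulr1].
have [|[p [Ip pu']] /= pmin] := @minimal_idempotent S sval s0.
  by move=> [q []].
exists p; split => // c pc uc.
have [q [Iq uq qc]] := disjunctive_product_pos pu pc uc.
have uq' : u * (1 - q) = u by rewrite mulrBr mulr1 uq subr0.
have Iq' := order_idempotentC Iq.
have Ipq := order_idempotentM Ip Iq'.
have upq : u * (p * (1 - q)) = u by rewrite mulrA pu'.
have <- : p * (1 - q) = p.
  by apply: pmin => //; exists (exist _ (p * (1 - q)) (conj Ipq upq)).
by rewrite -mulrA qc mulr0.
Qed.

(** The left support p of u satisfies (1 - p) a p = 0, hence p = 1. *)
Lemma irreducible_left_faithful a u (r : R[i]) c : irreducible a ->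
  poscone u -> u <> 0 -> a * u = r *: u ->
  poscone c -> c * u = 0 -> c = 0.
Proof.
move=> [pa airr] pu u0 au pc cu.
have [p [Ip pu' psupp]] := left_support pu.
have [_ /ale0 p0 p1] := Ip.
have corner : (1 - p) * a * p = 0.
  have [pp _ _] := Ip.
  have <- : (1 - p) * a * p * p = (1 - p) * a * p by rewrite -mulrA pp.
  apply: psupp; first by apply: posconeM => //; exact: posconeM.
  by rewrite -!mulrA pu' au -scalerAr mulrBl mul1r pu' subrr scaler0.
case: (airr p Ip corner) => pE; move: pu' (psupp c pc cu); rewrite pE.
  by rewrite mul0r => /esym.
by rewrite mulr1.
Qed.

(** The right support p of u satisfies p a (1 - p) = 0, so it is 1 - p that
    irreducibility is applied to. *)
Lemma irreducible_right_faithful a u (r : R[i]) c : irreducible a ->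
  poscone u -> u <> 0 -> u * a = r *: u ->
  poscone c -> u * c = 0 -> c = 0.
Proof.
move=> [pa airr] pu u0 ua pc uc.
have [p [Ip pu' psupp]] := right_support pu.
have [pp /ale0 p0 p1] := Ip.
have corner : (1 - (1 - p)) * a * (1 - p) = 0.
  rewrite subKr.
  have <- : p * (p * a * (1 - p)) = p * a * (1 - p) by rewrite !mulrA pp.
  apply: psupp; first by apply: posconeM => //; exact: posconeM.
  by rewrite !mulrA pu' ua -scalerAl mulrBr mulr1 pu' subrr scaler0.
case: (airr _ (order_idempotentC Ip) corner) => /eqP.
  rewrite subr_eq0 => /eqP pE; move: (psupp c pc uc).
  by rewrite -pE mul1r.
rewrite -subr_eq0 addrAC subrr sub0r oppr_eq0 => /eqP pE.
by move: pu'; rewrite pE mulr0 => /esym.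
Qed.

End FiniteDimensional.
End OrderIdempotents.

(** * The theorem *)

Unset Implicit Arguments.

Theorem theorem34 (R : realType) (A : orderedBanachAlgType R)
  (hfin : finite_dimensional A) (hdisj : disjunctive_product A)
  (a b : A) (ha : irreducible a) (hb : ale 0 b) (hba : alt b a) :
  spectral_radius b < spectral_radius a.
Proof.
have [pa _] := ha.
have pb := (ale0 b).1 hb.
have [ba neq] := hba.
have [u [pu u0 _ ua]] := perron hfin pa.
have [w [pw w0 bw _]] := perron hfin pb.
rewrite ltNge; apply/negP => rs; apply: neq.
have abw : (a - b) * w = 0.
  apply: (irreducible_right_faithful hfin hdisj ha pu u0 ua).
    exact: posconeM.
  apply: poscone_anti; first by apply: posconeM => //; exact: posconeM.
  have -> : - (u * ((a - b) * w))
      = (spectral_radius b - spectral_radius a)%:C *: (u * w).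
    rewrite mulrBl mulrBr mulrA ua bw -scalerAl -scalerAr.
    by rewrite opprB -scalerBl -rmorphB.
  by apply: posconeZ; [rewrite subr_ge0 | exact: posconeM].
apply/esym/eqP; rewrite -subr_eq0; apply/eqP.
have aw : a * w = (spectral_radius b)%:C *: w.
  by apply/eqP; rewrite -bw -subr_eq0 -mulrBl abw.
exact: (irreducible_left_faithful hfin hdisj ha pw w0 aw ba abw).
Qed.
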